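(* Let $n\ge2$, $\tau>0$, and let $\{A_s\}_{s\ge0}$ be the iterates of the spatially discretized generalized MBO algorithm. The non-stationary iterations (those with $A_{s+1}\neq A_s$) strictly decrease the value of $\tilde E^\tau$. For a given initial condition $A_0:\tilde\Omega\to O_n$, there exist a partition $\tilde\Omega=\tilde\Omega_+\amalg\tilde\Omega_-$ and an $S\in\mathbb N$ such that for all $s\ge S$, $$\det A_s(x_i)=\begin{cases}+1 & x_i\in\tilde\Omega_+\\ -1 & x_i\in\tilde\Omega_-.\end{cases}$$
   Context: $O_n$ is the group of real orthogonal $n\times n$ matrices and $\langle A,B\rangle_F=\sum_{i,j}A_{ij}B_{ij}$. $\tilde\Omega=\{x_i\}_{i=1}^{|\tilde\Omega|}$ is a finite grid in a closed manifold (e.g. a flat torus) $\Omega$, and $\tilde\Delta$ is a standard finite difference approximation of the Laplacian on $\tilde\Omega$, i.e. a real symmetric negative semidefinite $|\tilde\Omega|\times|\tilde\Omega|$ matrix; $e^{\tilde\Delta\tau}$ acts entrywise on matrix-valued functions on $\tilde\Omega$. For $A:\tilde\Omega\to O_n$, with $A_i=A(x_i)$, $$\tilde E^\tau(A)=\frac1\tau\sum_{x_i\in\tilde\Omega}\left(1-\langle A_i,(e^{\tilde\Delta\tau}A)_i\rangle_F\right).$$ The discretized generalized MBO algorithm iterates two steps: given $A_s:\tilde\Omega\to O_n$, compute $\tilde A=e^{\tilde\Delta\tau}A_s$; at each $x_i$ take a singular value decomposition $\tilde A(x_i)=U\Sigma V^t$ and set $A_{s+1}(x_i)=UV^t$,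 a closest orthogonal matrix to $\tilde A(x_i)$ in Frobenius norm (any choice of singular value decomposition is allowed if it is not unique). One of the parts $\tilde\Omega_\pm$ of the partition may be empty. *)

(* Defs.v *)
From HB Require Import structures.
From mathcomp Require Import all_boot all_order all_algebra.
From mathcomp Require Import all_classical all_reals all_analysis.

Set Implicit Arguments.
Unset Strict Implicit.
Unset Printing Implicit Defensive.

Import Order.TTheory GRing.Theory Num.Theory.
Import numFieldNormedType.Exports.

Local Open Scope classical_set_scope.
Local Open Scope ring_scope.

Definition orthogonal_mx (R : realType) (n : nat) (A : 'M[R]_n) : Prop :=
  A *m A^T = 1%:M.

Definition frobenius (R : realType) (n : nat) (A B : 'M[R]_n) : R :=
  \sum_i \sum_j A i j * B i j.

(* [symmetricmx] is MathComp's predicate M = M^T. *)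
Definition symmetric_nsd (R : realType) (N : nat) (D : 'M[R]_N) : Prop :=
  D \is symmetricmx /\ forall v : 'cV[R]_N, (v^T *m D *m v) 0 0 <= 0.

(* The limit is taken in the (product) topology of 'M[R]_N. *)
Definition expmx (R : realType) (N : nat) (M : 'M[R]_N) : 'M[R]_N :=
  limn (series (fun k => (k`!%:R)^-1 *: M ^+ k)).

(* The points x_i of the grid are identified with their indices i : 'I_N, so
   that a matrix field on the grid is an element of {ffun 'I_N -> 'M[R]_n}.
   Applying an N x N operator to each of the n^2 scalar entries of a field is
   the same as taking the matrix-valued combination below. *)
Definition act_entrywise (R : realType) (N n : nat) (P : 'M[R]_N)
    (A : {ffun 'I_N -> 'M[R]_n}) : {ffun 'I_N -> 'M[R]_n} :=
  [ffun i => \sum_j P i j *: A j].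

Definition diffuse (R : realType) (N n : nat) (D : 'M[R]_N) (tau : R)
    (A : {ffun 'I_N -> 'M[R]_n}) : {ffun 'I_N -> 'M[R]_n} :=
  act_entrywise (expmx (tau *: D)) A.

Definition mbo_energy (R : realType) (N n : nat) (D : 'M[R]_N) (tau : R)
    (A : {ffun 'I_N -> 'M[R]_n}) : R :=
  tau^-1 * \sum_i (1 - frobenius (A i) (diffuse D tau A i)).

(* The singular values s may come in any order; permuting them, and the columns
   of U and V accordingly, does not change U *m V^T. *)
Definition is_svd (R : realType) (n : nat) (M U : 'M[R]_n) (s : 'rV[R]_n)
    (V : 'M[R]_n) : Prop :=
  [/\ orthogonal_mx U, orthogonal_mx V, (forall k, 0 <= s 0 k)
    & M = U *m diag_mx s *m V^T].

(* A relation rather than a function: any singular value decomposition may be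
   chosen, independently at each grid point. *)
Definition mbo_step (R : realType) (N n : nat) (D : 'M[R]_N) (tau : R)
    (A A' : {ffun 'I_N -> 'M[R]_n}) : Prop :=
  forall i, exists U s V,
    is_svd (diffuse D tau A i) U s V /\ A' i = U *m V^T.

Definition mbo_iterates (R : realType) (N n : nat) (D : 'M[R]_N) (tau : R)
    (A : nat -> {ffun 'I_N -> 'M[R]_n}) : Prop :=
  (forall i, orthogonal_mx (A 0%N i)) /\
  (forall s, mbo_step D tau (A s) (A s.+1)).

(* Main.v *)
(* A real symmetric D is diagonalizable with real spectrum, so P = e^(tau D) is
   symmetric with c |x|^2 <= x^T P x <= C |x|^2 for some c > 0.  The new iterate
   A' maximizes <., P A> over orthogonal fields, so expanding <A', P A'> around A
   shows that it exceeds <A, P A> by at least c |A' - A|^2, which is the strict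
   decrease of the energy.  Since <A, P A> is bounded on orthogonal fields, these
   increments tend to 0; but orthogonal matrices with opposite determinants are
   at Frobenius distance at least 2, so the determinants are eventually
   constant. *)
Require Import Defs.
From HB Require Import structures.
From mathcomp Require Import all_boot all_order all_algebra.
From mathcomp Require Import all_classical all_reals all_analysis.
From mathcomp Require Import complex ring lra.

Set Implicit Arguments.
Unset Strict Implicit.
Unset Printing Implicit Defensive.

Import Order.TTheory GRing.Theory Num.Theory.
Import numFieldNormedType.Exports.

Local Open Scope ring_scope.

(** * Spectral formula and bounds for the exponential of a symmetric matrix *)

Lemma conjmx_diagX (R : comUnitRingType) (n k : nat) (P : 'M[R]_n)
    (d : 'rV[R]_n) :
  P \in unitmx ->
  (invmx P *m diag_mx d *m P) ^+ k =
  invmx P *m diag_mx (\row_j d 0 j ^+ k) *m P.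
Proof.
move=> uP; elim: k => [|k IHk].
  rewrite expr0 (_ : \row_j _ = const_mx 1) ?diag_const_mx ?mulmx1 ?mulVmx //.
  by apply/rowP => j; rewrite !mxE expr0.
rewrite exprS IHk -[LHS]/(_ *m _) -!mulmxA mulKVmx // (mulmxA (diag_mx d)).
rewrite mulmx_diag; congr (_ *m (diag_mx _ *m _)).
by apply/rowP => j; rewrite !mxE exprS.
Qed.

Lemma symmetricmxE (R : fieldType) (n : nat) (M : 'M[R]_n) :
  M \is symmetricmx -> forall i j, M i j = M j i.
Proof.
by move=> /is_hermitianmxP symM i j; rewrite {1}symM expr0 scale1r !mxE.
Qed.

(* The rows of [Q] are the real and the imaginary parts of the vectors of a
   complex orthonormal eigenbasis, so that [Q] has twice as many rows as [M]. *)
Lemma symmetricmx_spectral (R : rcfType) (n : nat) (M : 'M[R]_n) :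
  M \is symmetricmx ->
  exists (m : nat) (Q : 'M[R]_(m, n)) (d : 'rV[R]_m),
    forall k, M ^+ k = Q^T *m diag_mx (\row_j d 0 j ^+ k) *m Q.
Proof.
move=> symM; pose A := map_mx (real_complex R) M.
have hermA : A \is hermsymmx.
  apply: realsym_hermsym.
    apply/is_hermitianmxP/matrixP => i j; rewrite expr0 scale1r !mxE.
    by rewrite (symmetricmxE symM).
  by apply/mxOverP => i j; rewrite !mxE; apply/complex_realP; exists (M i j).
have dR := hermitian_spectral_diag_real hermA.
move/hermitian_normalmx/orthomx_spectralP : hermA.
have uP := spectral_unitarymx A.
set P := spectralmx A in uP *; set d := spectral_diag A in dR * => defA.
pose re := map_mx (@complex.Re R); pose im := map_mx (@complex.Im R).
exists (n + n)%N, (col_mx (re _ _ P) (im _ _ P)).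
exists (row_mx (re _ _ d) (re _ _ d)) => k.
have Ak : map_mx (real_complex R) (M ^+ k) = A ^+ k.
  elim: k => [|k IHk]; first by rewrite !expr0 map_mx1.
  by rewrite !exprS -[M * _]/(_ *m _) map_mxM IHk.
apply/matrixP => i j.
have := congr1 (fun B : 'M[R[i]]_n => complex.Re (B i j)) Ak.
rewrite [LHS]/= mxE /= => ->.
rewrite defA conjmx_diagX ?unitarymx_unit // invmx_unitary //.
(* For real [x], the real part of [(a - ib) x (a' + ib')] is [a x a' + b x b']: the two terms come
   from the two blocks of [Q]. *)
rewrite !mul_mx_diag !mxE big_split_ord /= raddf_sum /=.
rewrite -big_split /=.
apply: eq_bigr => l _; rewrite !mxE !(unsplitK (inl l)) !(unsplitK (inr l)) !mxE.
have /complex_realP[x ->] : d 0 l \is Num.real by move/mxOverP: dR; apply.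
rewrite -rmorphXn /=; case: (P l i) => a b; case: (P l j) => a' b' /=.
by rewrite !mulr0 !oppr0 !addr0 !add0r; ring.
Qed.

Lemma cvg_mx (T : topologicalType) (m n : nat) (u : nat -> 'M[T]_(m, n))
    (l : 'M[T]_(m, n)) :
  (forall i j, (fun k => u k i j) @ \oo --> l i j)%classic ->
  (u @ \oo --> l)%classic.
Proof.
move=> ul B [P lP sPB]; near=> k; apply: sPB => i j.
move: i j; near: k.
apply: filter_forall => i; apply: filter_forall => j.
exact: (ul i j _ (lP i j)).
Unshelve. all: by end_near. Qed.

(** Each entry of a partial sum of the matrix series is a fixed finite combination of partial sums
    of the scalar series at the [d 0 l]. *)
Lemma expmx_spectral (R : realType) (n : nat) (M : 'M[R]_n) :
  M \is symmetricmx ->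
  exists (m : nat) (Q : 'M[R]_(m, n)) (d : 'rV[R]_m),
    Q^T *m Q = 1%:M /\ expmx M = Q^T *m diag_mx (map_mx expR d) *m Q.
Proof.
move=> /symmetricmx_spectral[m [Q [d Mk]]]; exists m, Q, d; split.
  (* The case [k = 0] of the spectral formula says that the columns of [Q] are orthonormal. *)
  have := Mk 0%N; rewrite expr0 (_ : \row_j _ = const_mx 1).
    by rewrite diag_const_mx mulmx1.
  by apply/rowP => j; rewrite !mxE expr0.
apply: cvg_lim; first exact: norm_hausdorff.
apply: cvg_mx => i j; rewrite mul_mx_diag mxE.
have -> : (fun k => series (fun k => k`!%:R^-1 *: M ^+ k) k i j) =
    (fun k => \sum_l Q l i * series (exp_coeff (d 0 l)) k * Q l j).
  apply/funext => k; rewrite /series /= summxE.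
  under [RHS]eq_bigr do rewrite mulr_sumr mulr_suml.
  rewrite exchange_big; apply: eq_bigr => q _.
  rewrite Mk mul_mx_diag !mxE mulr_sumr; apply: eq_bigr => l _.
  by rewrite !mxE exp_coeffE; ring.
apply: cvg_big => [|l _]; [exact: add_continuous|rewrite !mxE].
by apply: cvgMl; apply: cvgMr; exact: is_cvg_series_exp_coeff.
Qed.

Lemma expmx_symmetric (R : realType) (n : nat) (M : 'M[R]_n) :
  M \is symmetricmx -> forall i j, expmx M i j = expmx M j i.
Proof.
move=> /expmx_spectral[m [Q [d [_ ->]]]] i j.
by rewrite mul_mx_diag !mxE; apply: eq_bigr => l _; rewrite !mxE; ring.
Qed.

(** With [y = Q x], the form becomes a sum of squares [y l ^+ 2] with weights [expR (d 0 l)], and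
    [y] has the norm of [x]. *)
Lemma expmx_bounds (R : realType) (n : nat) (M : 'M[R]_n) :
  M \is symmetricmx ->
  exists c C : R, 0 < c /\ forall x : 'I_n -> R,
    c * \sum_i x i ^+ 2 <= \sum_i \sum_j expmx M i j * x i * x j
      <= C * \sum_i x i ^+ 2.
Proof.
move=> /expmx_spectral[m [Q [d [QQ ->]]]].
(* Any common bound of the [|d l|] would do; a sum avoids a maximum over a possibly empty index
   set. *)
pose b := \sum_l `|d 0 l|.
have dle l : `|d 0 l| <= b.
  by rewrite /b (bigD1 l) //= lerDl sumr_ge0.
exists (expR (- b)), (expR b); split; first exact: expR_gt0.
move=> x; pose y l := \sum_j Q l j * x j.
(* Used with [w = 1] for the norm of [x] and with [w = expR d] for the form of [expmx M]. *)
have quad (w : 'I_m -> R) :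
    \sum_l w l * y l ^+ 2 =
    \sum_i \sum_j (\sum_l Q l i * w l * Q l j) * x i * x j.
  under eq_bigr do rewrite expr2 mulr_suml mulr_sumr.
  rewrite exchange_big; apply: eq_bigr => i _.
  under eq_bigr do rewrite !mulr_sumr.
  rewrite exchange_big; apply: eq_bigr => j _.
  by rewrite -mulrA mulr_suml; apply: eq_bigr => l _; ring.
have -> : \sum_i x i ^+ 2 = \sum_l y l ^+ 2.
  under [RHS]eq_bigr do rewrite -[_ ^+ 2]mul1r.
  rewrite quad; apply: eq_bigr => i _; rewrite (bigD1 i) //=.
  have QQE j : \sum_l Q l i * 1 * Q l j = (i == j)%:R.
    have /matrixP/(_ i j) := QQ; rewrite !mxE => <-.
    by apply: eq_bigr => l _; rewrite !mxE mulr1.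
  rewrite QQE eqxx big1 ?addr0 ?expr2 ?mul1r // => j.
  by rewrite QQE eq_sym => /negPf->; rewrite !mul0r.
have -> : \sum_i \sum_j (Q^T *m diag_mx (map_mx expR d) *m Q) i j * x i * x j =
    \sum_l expR (d 0 l) * y l ^+ 2.
  rewrite quad; apply: eq_bigr => i _; apply: eq_bigr => j _.
  rewrite mul_mx_diag !mxE; congr (_ * _ * _).
  by apply: eq_bigr => l _; rewrite !mxE.
rewrite !mulr_sumr; apply/andP; split; apply: ler_sum => l _;
  apply: ler_wpM2r; rewrite ?sqr_ge0 // ler_expR;
  by have := dle l; rewrite ler_norml => /andP[].
Qed.

(** * Frobenius product and orthogonal matrices *)

Lemma frobeniusE (R : realType) (n : nat) (A B : 'M[R]_n) :
  frobenius A B = \tr (A^T *m B).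
Proof.
rewrite /frobenius exchange_big; apply: eq_bigr => j _.
by rewrite mxE; apply: eq_bigr => i _; rewrite mxE.
Qed.

Lemma frobeniusBl (R : realType) (n : nat) (A B C : 'M[R]_n) :
  frobenius (A - B) C = frobenius A C - frobenius B C.
Proof. by rewrite !frobeniusE linearB mulmxBl linearB. Qed.

Lemma frobenius_ge0 (R : realType) (n : nat) (A : 'M[R]_n) : 0 <= frobenius A A.
Proof. by do 2!(apply: sumr_ge0 => ? _); rewrite -expr2 sqr_ge0. Qed.

Lemma frobenius_eq0 (R : realType) (n : nat) (A : 'M[R]_n) :
  frobenius A A = 0 -> A = 0.
Proof.
have ge0 i : 0 <= \sum_j A i j * A i j.
  by apply: sumr_ge0 => j _; rewrite -expr2 sqr_ge0.
have sq0 i j : 0 <= A i j * A i j by rewrite -expr2 sqr_ge0.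
move=> A0; apply/matrixP => i j; rewrite mxE; apply/eqP; rewrite -sqrf_eq0 expr2.
rewrite eq_le sq0 andbT -[leRHS]A0 (@le_trans _ _ (\sum_k A i k * A i k)) //.
  by rewrite [leRHS](bigD1 j) //= lerDl sumr_ge0.
by rewrite /frobenius [leRHS](bigD1 i) //= lerDl sumr_ge0.
Qed.

Lemma orthogonal_tr (R : realType) (n : nat) (A : 'M[R]_n) :
  orthogonal_mx A -> orthogonal_mx A^T.
Proof. by rewrite /orthogonal_mx trmxK => /mulmx1C. Qed.

Lemma orthogonalM (R : realType) (n : nat) (A B : 'M[R]_n) :
  orthogonal_mx A -> orthogonal_mx B -> orthogonal_mx (A *m B).
Proof.
rewrite /orthogonal_mx => oA oB.
by rewrite trmx_mul mulmxA -(mulmxA A) oB mulmx1.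
Qed.

Lemma orthogonal_le1 (R : realType) (n : nat) (A : 'M[R]_n) i j :
  orthogonal_mx A -> A i j <= 1.
Proof.
move=> /matrixP/(_ i i); rewrite !mxE eqxx => Ai.
have : A i j ^+ 2 <= 1.
  rewrite -[1]Ai (bigD1 j) //= mxE -expr2 lerDl.
  by apply: sumr_ge0 => k _; rewrite mxE -expr2 sqr_ge0.
by move=> ?; nra.
Qed.

Lemma frobenius_orthogonal (R : realType) (n : nat) (A : 'M[R]_n) :
  orthogonal_mx A -> frobenius A A = n%:R.
Proof.
move=> /orthogonal_tr; rewrite /orthogonal_mx trmxK frobeniusE => ->.
exact: mxtrace1.
Qed.

Lemma orthogonal_detE (R : realType) (n : nat) (A : 'M[R]_n) :
  orthogonal_mx A -> \det A = 1 \/ \det A = -1.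
Proof.
move=> /(congr1 determinant); rewrite det_mulmx det_tr det1 -expr2 => /eqP.
by rewrite sqrf_eq1 => /orP[] /eqP; [left|right].
Qed.

(** By cyclicity of the trace, the product of [W] with [M] weights the diagonal of the matrix
    [V^T W^T U] by the singular values. For orthogonal [W] these diagonal entries are at most 1, and
    for [W = U V^T] they all equal 1. *)
Lemma svd_frobenius_max (R : realType) (n : nat) (M U : 'M[R]_n) (s : 'rV[R]_n)
    (V B : 'M[R]_n) :
  is_svd M U s V -> orthogonal_mx B -> frobenius B M <= frobenius (U *m V^T) M.
Proof.
case=> oU oV s0 -> oB.
have trE (W : 'M[R]_n) :
    frobenius W (U *m diag_mx s *m V^T) = \sum_k (V^T *m W^T *m U) k k * s 0 k.
  rewrite frobeniusE mulmxA mxtrace_mulC !mulmxA mul_mx_diag.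
  by apply: eq_bigr => k _; rewrite mxE.
rewrite !trE; apply: ler_sum => k _; apply: ler_wpM2r => //.
have -> : V^T *m (U *m V^T)^T *m U = 1%:M.
  have := orthogonal_tr oU; rewrite /orthogonal_mx trmxK => UU.
  have := orthogonal_tr oV; rewrite /orthogonal_mx trmxK => VV.
  by rewrite trmx_mul trmxK mulmxA VV mul1mx.
rewrite [leRHS]mxE eqxx; apply: orthogonal_le1.
by apply: orthogonalM => //; apply: orthogonalM; exact: orthogonal_tr.
Qed.

(** This is the Cauchy-Schwarz inequality applied to each column of [M], obtained from Lagrange's
    identity. *)
Lemma mulmx_row_le (R : realType) (n : nat) (v : 'rV[R]_n) (M : 'M[R]_n) :
  \sum_j (v *m M) 0 j ^+ 2 <= (\sum_i v 0 i ^+ 2) * frobenius M M.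
Proof.
rewrite /frobenius exchange_big /= mulr_sumr; apply: ler_sum => j _.
rewrite mxE -subr_ge0.
have : 0 <= \sum_i \sum_k (v 0 i * M k j - v 0 k * M i j) ^+ 2.
  by do 2!apply: sumr_ge0 => ? _; exact: sqr_ge0.
suff -> : \sum_i \sum_k (v 0 i * M k j - v 0 k * M i j) ^+ 2 =
  2 * ((\sum_i v 0 i ^+ 2) * (\sum_i M i j * M i j) -
       (\sum_i v 0 i * M i j) ^+ 2) by rewrite pmulr_rge0.
(* Writing the product in both orders matches the two squares in the expanded double sum, with [i]
   and [k] exchanged. *)
have E (a b c : R) : 2 * (a * b - c ^+ 2) = a * b + b * a - c * c - c * c by ring.
rewrite E !mulr_suml -big_split -!sumrB; apply: eq_bigr => i _ /=.
rewrite !mulr_sumr -big_split -!sumrB; apply: eq_bigr => k _ /=.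
ring.
Qed.

Lemma row_sqr_norm (R : realType) (n : nat) (v : 'rV[R]_n) :
  \sum_j v 0 j ^+ 2 = (v *m v^T) 0 0.
Proof. by rewrite mxE; apply: eq_bigr => j _; rewrite mxE expr2. Qed.

(* If [\det A = - \det B], then [A + B = A (A + B)^T B] is singular, and
   [A - B] doubles the norm of the vectors in its kernel. *)
Lemma orthogonal_det_neq (R : realType) (n : nat) (A B : 'M[R]_n) :
  orthogonal_mx A -> orthogonal_mx B -> \det A != \det B ->
  4 <= frobenius (A - B) (A - B).
Proof.
move=> oA oB dAB.
have dN : \det A * \det B = -1.
  move: dAB; case: (orthogonal_detE oA) (orthogonal_detE oB) => -> [] ->;
  by rewrite ?eqxx ?mul1r ?mulr1.
have /det0P[v v0 vAB] : \det (A + B) == 0.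
  have : \det (A + B) = - \det (A + B).
    have BB : B^T *m B = 1%:M.
      by have := orthogonal_tr oB; rewrite /orthogonal_mx trmxK.
    rewrite -[RHS]mulN1r -[X in _ = _ * X]det_tr -dN mulrAC -!det_mulmx.
    by rewrite linearD mulmxDr mulmxDl oA mul1mx -mulmxA BB mulmx1 addrC.
  by move=> ?; apply/eqP; lra.
have vv : 0 < \sum_j v 0 j ^+ 2.
  rewrite lt_def sumr_ge0 ?andbT => [|j _]; last exact: sqr_ge0.
  apply: contra v0; rewrite psumr_eq0 => [/allP v0|j _]; last exact: sqr_ge0.
  apply/eqP/rowP => j; rewrite mxE; apply/eqP; rewrite -sqrf_eq0.
  exact: v0 (mem_index_enum j).
have vB : v *m B = - (v *m A).
  by apply/eqP; rewrite -addr_eq0 addrC -mulmxDr vAB.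
(* After scaling by [|v|^2], it remains to see that [|v (A - B)|^2 = |2 v A|^2 = 4 |v|^2]. *)
rewrite -(ler_pM2l vv); apply: le_trans (mulmx_row_le _ _).
have -> : v *m (A - B) = 2 *: (v *m A).
  by rewrite mulmxBr vB opprK scaler_nat.
have -> : \sum_j (2 *: (v *m A)) 0 j ^+ 2 = 4 * \sum_j (v *m A) 0 j ^+ 2.
  by rewrite mulr_sumr; apply: eq_bigr => j _; rewrite mxE; ring.
by rewrite !row_sqr_norm trmx_mul mulmxA -(mulmxA v) oA mulmx1 mulrC.
Qed.

(** * The bilinear form [<X, P Y>] on matrix fields *)

Definition grid_form (R : realType) (N n : nat) (P : 'M[R]_N)
    (X Y : {ffun 'I_N -> 'M[R]_n}) : R :=
  \sum_i frobenius (X i) (act_entrywise P Y i).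

(** Separating the matrix entries [a], [b] reduces symmetry and bounds of the form to those of the
    scalar form of [P]. *)
Lemma grid_formE (R : realType) (N n : nat) (P : 'M[R]_N)
    (X Y : {ffun 'I_N -> 'M[R]_n}) :
  grid_form P X Y =
  \sum_a \sum_b \sum_i \sum_j P i j * X i a b * Y j a b.
Proof.
rewrite /grid_form /frobenius exchange_big; apply: eq_bigr => a _.
rewrite exchange_big; apply: eq_bigr => b _; apply: eq_bigr => i _.
rewrite ffunE summxE mulr_sumr; apply: eq_bigr => j _.
by rewrite mxE; ring.
Qed.

Lemma grid_formC (R : realType) (N n : nat) (P : 'M[R]_N)
    (X Y : {ffun 'I_N -> 'M[R]_n}) :
  (forall i j, P i j = P j i) -> grid_form P X Y = grid_form P Y X.
Proof.
move=> symP; rewrite !grid_formE; apply: eq_bigr => a _; apply: eq_bigr => b _.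
rewrite exchange_big; apply: eq_bigr => i _; apply: eq_bigr => j _.
by rewrite symP; ring.
Qed.

Lemma grid_formBl (R : realType) (N n : nat) (P : 'M[R]_N)
    (X Y Z : {ffun 'I_N -> 'M[R]_n}) :
  grid_form P (X - Y) Z = grid_form P X Z - grid_form P Y Z.
Proof.
rewrite /grid_form -sumrB; apply: eq_bigr => i _.
by rewrite !ffunE frobeniusBl.
Qed.

Lemma grid_form_bounds (R : realType) (N n : nat) (P : 'M[R]_N) (c C : R) :
  (forall x : 'I_N -> R, c * \sum_i x i ^+ 2 <=
     \sum_i \sum_j P i j * x i * x j <= C * \sum_i x i ^+ 2) ->
  forall X : {ffun 'I_N -> 'M[R]_n},
    c * \sum_i frobenius (X i) (X i) <= grid_form P X X
      <= C * \sum_i frobenius (X i) (X i).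
Proof.
move=> bnd X.
have -> : \sum_i frobenius (X i) (X i) = \sum_a \sum_b \sum_i X i a b ^+ 2.
  rewrite /frobenius exchange_big; apply: eq_bigr => a _.
  by rewrite exchange_big.
rewrite grid_formE !mulr_sumr; apply/andP; split; apply: ler_sum => a _;
  rewrite mulr_sumr; apply: ler_sum => b _;
  by have /andP[] := bnd (fun i => X i a b).
Qed.

(** * Energy and determinants along the iteration *)

Lemma mbo_energyE (R : realType) (N n : nat) (D : 'M[R]_N) (tau : R)
    (A : {ffun 'I_N -> 'M[R]_n}) :
  mbo_energy D tau A = tau^-1 * (N%:R - grid_form (expmx (tau *: D)) A A).
Proof.
by rewrite /mbo_energy sumrB sumr_const card_ord.
Qed.

Lemma mbo_iterates_orthogonal (R : realType) (N n : nat) (D : 'M[R]_N)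
    (tau : R) (A : nat -> {ffun 'I_N -> 'M[R]_n}) :
  mbo_iterates D tau A -> forall s i, orthogonal_mx (A s i).
Proof.
case=> A0 step [|s] i //; have [U [S [V [[oU oV _ _] ->]]]] := step s i.
by apply: orthogonalM => //; exact: orthogonal_tr.
Qed.

(* Expanding the quadratic form at [A' = A + (A' - A)], the first-order term
   is nonnegative since [A'] maximizes [<., P A>] over orthogonal fields. *)
Lemma mbo_step_increase (R : realType) (N n : nat) (D : 'M[R]_N) (tau c C : R)
    (A A' : {ffun 'I_N -> 'M[R]_n}) (P := expmx (tau *: D)) :
  (forall i j, P i j = P j i) ->
  (forall x : 'I_N -> R, c * \sum_i x i ^+ 2 <=
     \sum_i \sum_j P i j * x i * x j <= C * \sum_i x i ^+ 2) ->
  (forall i, orthogonal_mx (A i)) -> mbo_step D tau A A' ->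
  grid_form P A A + c * \sum_i frobenius (A' i - A i) (A' i - A i)
    <= grid_form P A' A'.
Proof.
move=> symP bnd oA step.
have first : grid_form P A A <= grid_form P A' A.
  apply: ler_sum => i _; have [U [s [V [svd ->]]]] := step i.
  exact: svd_frobenius_max svd (oA i).
(* By symmetry, [<A' - A, P (A' - A)> = <A', P A'> - 2 <A', P A> + <A, P A>]; the lower bound on the
   left and [first] then give the claim. *)
have /andP[+ _] := grid_form_bounds bnd (A' - A).
rewrite grid_formBl !(grid_formC _ (A' - A)) // !grid_formBl (grid_formC A A') //.
under eq_bigr do rewrite !ffunE.
move=> ?; lra.
Qed.

(** Once [u S] is within [e] of the supremum, monotonicity leaves less than [e] for every later
    increment. *)
Lemma eventually_small_increments (R : realType) (u : nat -> R) (b e : R) :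
  (forall s, u s <= u s.+1) -> (forall s, u s <= b) -> 0 < e ->
  exists S : nat, forall s, (S <= s)%N -> u s.+1 - u s < e.
Proof.
move=> incr ub e0.
have mono : {homo u : m k / (m <= k)%N >-> m <= k}.
  by apply: homo_leq => //; exact: le_trans.
have supu : has_sup (range u).
  by split; [exists (u 0%N), 0%N|exists b => _ [s _ <-]].
have [_ [S _ <-] uS] := sup_adherent e0 supu; exists S => s Ss.
have : u s.+1 <= sup (range u) by apply: ub_le_sup; [case: supu|exists s.+1].
have := mono _ _ Ss; move=> ? ?; lra.
Qed.

Theorem proposition4p6 (R : realType) (n N : nat) (D : 'M[R]_N) (tau : R)
    (A : nat -> {ffun 'I_N -> 'M[R]_n}) :
  (2 <= n)%N -> 0 < tau -> symmetric_nsd D -> mbo_iterates D tau A ->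
  (forall s : nat, A s.+1 <> A s ->
     mbo_energy D tau (A s.+1) < mbo_energy D tau (A s)) /\
  (exists Op Om : {set 'I_N},
     (Op :|: Om = [set: 'I_N])%SET /\ [disjoint Op & Om] /\
     exists S : nat, forall s : nat, (S <= s)%N ->
       (forall i, i \in Op -> \det (A s i) = 1) /\
       (forall i, i \in Om -> \det (A s i) = -1)).
Proof.
move=> _ tau0 [symD _] iter; have oA := mbo_iterates_orthogonal iter.
case: iter => _ step.
have symM : tau *: D \is symmetricmx.
  apply/is_hermitianmxP/matrixP => i j; rewrite expr0 scale1r !mxE.
  by rewrite (symmetricmxE symD).
have [c [C [c0 bnd]]] := expmx_bounds symM.
have symP := expmx_symmetric symM.
pose J s := grid_form (expmx (tau *: D)) (A s) (A s).
have incr s := mbo_step_increase symP bnd (oA s) (step s).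
have diff_ge0 s i : 0 <= frobenius (A s.+1 i - A s i) (A s.+1 i - A s i).
  exact: frobenius_ge0.
split=> [s As|].
  rewrite !mbo_energyE ltr_pM2l ?invr_gt0 // ltrD2l ltrN2.
  (* The gain is positive unless every summand vanishes, which would make the two fields equal. *)
  apply: lt_le_trans (incr s); rewrite ltrDl mulr_gt0 // lt_def sumr_ge0 // andbT.
  apply/eqP => /eqP; rewrite psumr_eq0 // => /allP dA0; apply: As.
  apply/ffunP => i; apply/eqP; rewrite -subr_eq0; apply/eqP/frobenius_eq0/eqP.
  exact: dA0 (mem_index_enum i).
(* The bound comes from [N] orthogonal matrices of squared norm [n]; the threshold [c * 4] is the
   least gain in [J] when a determinant flips at even one point. *)
have [] := @eventually_small_increments R J (C * (N%:R * n%:R)) (c * 4).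
- move=> s; apply: le_trans (incr s); rewrite lerDl mulr_ge0 ?(ltW c0) //.
  exact: sumr_ge0.
- move=> s; have /andP[_] := grid_form_bounds bnd (A s).
  under eq_bigr do rewrite frobenius_orthogonal //.
  by rewrite sumr_const card_ord -[_ *+ N]mulr_natl.
- by rewrite mulr_gt0.
move=> S small.
have detS s : (S <= s)%N -> forall i, \det (A s i) = \det (A S i).
  elim: s => [|s IHs]; first by rewrite leqn0 => /eqP->.
  rewrite leq_eqVlt => /predU1P[<- //|]; rewrite ltnS => Ss i.
  rewrite -(IHs Ss); apply/eqP/negPn/negP => dets.
  have : c * 4 <= c * \sum_j frobenius (A s.+1 j - A s j) (A s.+1 j - A s j).
    rewrite ler_pM2l //; apply: le_trans (orthogonal_det_neq _ _ dets) _ => //.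
    by rewrite [leRHS](bigD1 i) //= lerDl sumr_ge0.
  by have := small s Ss; have := incr s; rewrite /J => ? ? ?; lra.
(* The signs at time [S] define the partition; a determinant other than 1 is -1 by orthogonality. *)
exists [set i | \det (A S i) == 1], [set i | \det (A S i) != 1].
split; first by apply/setP => i; rewrite !inE orbN.
split.
  rewrite finset.disjoints_subset; apply/fintype.subsetP => i.
  by rewrite !inE negbK.
exists S => s Ss; split=> i; rewrite inE detS //; first by move/eqP.
by case: (orthogonal_detE (oA S i)) => ->; rewrite ?eqxx.
Qed.
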